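(* Let $c\in X^*$, $b\in Y$, and let $Y_0:=\operatorname{span}(A(P)-Q)$ be endowed with the topology induced from $Y$. Assume that one of the following conditions is verified: (i) there exists $\lambda_0\in\mathbb{R}$ such that $N_0:=\{y\in Y\mid \exists x\in P:\ Ax-y\in Q \text{ and } \langle x,c\rangle\le\lambda_0\}$ is a neighborhood of $b$ in $Y_0$; (ii) there exists $x_0\in P$ such that $Ax_0-b\in\operatorname{int}_{Y_0}Q$; (iii) $X$ and $Y$ are Fréchet spaces, $P$, $Q$ and $Y_0$ are closed, and $b\in\operatorname{icr}(A(P)-Q)$; (iv) $\dim Y_0<\infty$ and $b\in\operatorname{icr}(A(P)-Q)$. Then either (a) $h_c(y)=-\infty$ for every $y\in\operatorname{icr}(A(P)-Q)$, and so $\operatorname{val}(P_{c,b})=\operatorname{val}(P^*_{c,b})=-\infty$, or (b) $c\in P^++A^*(Q^+)$ and $h_c|_{Y_0}$ is continuous at $b$. Consequently, in the case (b), $\partial h_c(b)\neq\emptyset$, whence $\operatorname{val}(P_{c,b})=\operatorname{val}(P^*_{c,b})\in\mathbb{R}$ and $(P^*_{c,b})$ has optimal solutions; moreover, if $Y_0=Y$, then the set $\operatorname{Sol}(P^*_{c,b})$ of optimal solutions of $(P^*_{c,b})$ is $w^*$-compact.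
   Context: $X,Y$ are real Hausdorff locally convex spaces with topological duals $X^*,Y^*$; $w^*$ denotes the weak-star topology; $\langle x,x^*\rangle:=x^*(x)$. $A:X\to Y$ is a continuous linear operator with adjoint $A^*:Y^*\to X^*$, $A^*y^*=y^*\circ A$. $P\subset X$, $Q\subset Y$ are convex cones (nonempty sets closed under addition and under multiplication by scalars $t\in[0,\infty[$; not assumed closed unless stated), and $P^+:=\{x^*\in X^*\mid \langle x,x^*\rangle\ge 0\ \forall x\in P\}$, $Q^+:=\{y^*\in Y^*\mid\langle y,y^*\rangle\ge0\ \forall y\in Q\}$. For $c\in X^*$, $b\in Y$: $(P_{c,b})$: minimize $\langle x,c\rangle$ subject to $x\in P$, $Ax-b\in Q$; $(P^*_{c,b})$: maximize $\langle b,y^*\rangle$ subject to $y^*\in Q^+$, $A^*y^*-c\in -P^+$. Their values in $\overline{\mathbb{R}}=\mathbb{R}\cup\{-\infty,\infty\}$ are $\operatorname{val}(P_{c,b})$ and $\operatorname{val}(P^*_{c,b})$, with $\inf\emptyset=\infty$, $\sup\emptyset=-\infty$. The value function is $h_c:Y\to\overline{\mathbb{R}}$, $h_c(y):=\inf\{\langle x,c\rangle\mid x\in P,\ Ax-y\in Q\}$. The subdifferential is $\partial h_c(y):=\{y^*\in Y^*\mid\langle y'-y,y^*\rangle\le h_c(y')-h_c(y)\ \forall y'\in Y\}$ if $h_c(y)\in\mathbb{R}$, and $\emptyset$ otherwise. $\operatorname{int}_{Y_0}$ denotes the interior relative to $Y_0$. For a nonempty subset $E$ of a real vector space, the intrinsic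 core is $\operatorname{icr}E:=\{x_0\mid \forall x\in\operatorname{aff}E,\ \exists\delta>0,\ \forall\lambda\in\mathbb{R}:\ |\lambda|\le\delta\Rightarrow(1-\lambda)x_0+\lambda x\in E\}$, where $\operatorname{aff}E$ is the affine hull of $E$. *)

(* Defs.v *)
From HB Require Import structures.
From mathcomp Require Import all_boot all_order all_algebra.
From mathcomp Require Import all_classical all_reals all_analysis.

Set Implicit Arguments.
Unset Strict Implicit.
Unset Printing Implicit Defensive.

Import Order.TTheory GRing.Theory Num.Theory.
Import numFieldNormedType.Exports.

Local Open Scope classical_set_scope.
Local Open Scope ring_scope.

Section continuous_linear_maps.
Context {R : realType} (E F : tvsType R).

Definition clin_pred : {pred E -> F} :=
  mem [set f : E -> F | linear f /\ continuous f].

Record clin := Clin { clin_fun :> E -> F ; clin_subproof : clin_fun \in clin_pred }.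

HB.instance Definition _ := [isSub for clin_fun].
HB.instance Definition _ := [Choice of clin by <:].

Lemma clin_linear (f : clin) : linear f.
Proof. by have := clin_subproof f; rewrite inE => -[]. Qed.

Lemma clin_continuous (f : clin) : continuous f.
Proof. by have := clin_subproof f; rewrite inE => -[]. Qed.

HB.instance Definition _ (f : clin) :=
  GRing.isLinear.Build R E F *:%R f (clin_linear f).

Lemma clin_submod_closed : submod_closed clin_pred.
Proof.
split=> [|a f g].
  rewrite inE; split; first by move=> k x y /=; rewrite [RHS]addr0 [RHS]scaler0.
  by move=> x; exact: cvg_cst.
rewrite !inE => -[lf cf] [lg cg]; split.
  move=> k x y; rewrite -[LHS]/(a *: f _ + g _).
  rewrite -[RHS]/(k *: (a *: f x + g x) + (a *: f y + g y)).
  by rewrite lf lg !scalerDr !scalerA (mulrC a) addrACA.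
move=> x.
apply: (@continuous_comp _ _ _ (fun x => (a *: f x, g x))
  (fun z : F * F => z.1 + z.2)); last exact: add_continuous.
apply: cvg_pair; last exact: cg.
apply: (@continuous_comp E (R^o * F)%type F (fun x => (a, f x))
  (fun z => z.1 *: z.2)); last exact: scale_continuous.
by apply: (@cvg_pair _ _ _ _ (nbhs (a : R^o))); [exact: cvg_cst|exact: cf].
Qed.

HB.instance Definition _ :=
  GRing.isSubmodClosed.Build R (E -> F) clin_pred clin_submod_closed.
HB.instance Definition _ := [SubChoice_isSubLmodule of clin by <:].

End continuous_linear_maps.

Definition dual {R : realType} (E : tvsType R) := clin E R^o.

(* The dual with its weak-star topology, i.e. that of pointwise convergence. *)
Definition weak_star {R : realType} (E : tvsType R) :=
  initial_topology (fun f : dual E => (f : {ptws E -> R^o})).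

Lemma adjoint_subproof {R : realType} (E F : tvsType R) (A : clin E F)
  (y : dual F) : (y \o A : E -> R^o) \in @clin_pred R E R^o.
Proof.
rewrite inE; split; first by move=> a u v /=; rewrite !linearP.
by move=> x; apply: continuous_comp; exact: clin_continuous.
Qed.

Definition adjoint {R : realType} (E F : tvsType R) (A : clin E F)
  (y : dual F) : dual E := Clin (adjoint_subproof A y).

Section spans.
Context {R : realType} {V : lmodType R}.
Implicit Types E L : set V.

Definition linear_subspace L :=
  L 0 /\ forall (a : R) x y, L x -> L y -> L (a *: x + y).

Definition affine_set L :=
  forall (a : R) x y, L x -> L y -> L ((1 - a) *: x + a *: y).

Definition linear_span E : set V := smallest linear_subspace E.

Definition affine_hull E : set V := smallest affine_set E.

Definition finite_dimensional L := exists s : seq V, L = linear_span [set` s].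

Definition icr E : set V :=
  [set x0 | forall x, affine_hull E x -> exists2 d : R, 0 < d &
     forall l : R, `|l| <= d -> E ((1 - l) *: x0 + l *: x)].

Definition convex_cone E :=
  [/\ E !=set0, forall x y, E x -> E y -> E (x + y) &
      forall (t : R) x, 0 <= t -> E x -> E (t *: x)].

End spans.

(* The point has to be required in L: outside L, [subspace L] is discrete. *)
Definition rel_nbhs {T : topologicalType} (L : set T) (x : T) (N : set T) :=
  L x /\ nbhs (x : subspace L) N.

Definition rel_interior {T : topologicalType} (L N : set T) : set T :=
  [set x | rel_nbhs L x N].

(* Completeness is that of a translation-invariant metric rather than that of  *)
(* the uniformity carried by a tvsType, which induces the topology but need    *)
(* not be translation-invariant. Local convexity is part of tvsType.           *)
Definition frechet_space {R : realType} (E : tvsType R) :=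
  exists d : E -> E -> R,
  [/\ [/\ forall x y, d x y = 0 <-> x = y,
          forall x y, d x y = d y x &
          forall x y z, d x z <= d x y + d y z],
      forall x y z, d (x + z) (y + z) = d x y,
      forall x, nbhs x =
        filter_from [set e : R | 0 < e] (fun e => [set y | d x y < e]) &
      forall u : nat -> E,
        (forall e : R, 0 < e -> exists N : nat, forall m n : nat,
           (N <= m)%N -> (N <= n)%N -> d (u m) (u n) < e) ->
        exists l : E, u n @[n --> \oo] --> l].

Definition pos_dual {R : realType} (E : tvsType R) (P : set E) : set (dual E) :=
  [set f | forall x, P x -> 0 <= f x].

Definition subdifferential {R : realType} (E : tvsType R) (h : E -> \bar R)
    (y : E) : set (dual E) :=
  [set f | h y \is a fin_num /\
     forall y', ((f (y' - y) : R)%:E <= h y' - h y)%E].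

Section conic_programs.
Context {R : realType} {X Y : tvsType R}.
Variables (A : clin X Y) (P : set X) (Q : set Y).
Implicit Types (c : dual X) (b y : Y).

Definition primal_feasible b : set X := [set x | P x /\ Q (A x - b)].

Definition val_primal c b : \bar R :=
  ereal_inf [set (c x : R)%:E | x in primal_feasible b].

Definition dual_feasible c : set (dual Y) :=
  [set f | pos_dual Q f /\ [set - g | g in pos_dual P] (adjoint A f - c)].

Definition val_dual c b : \bar R :=
  ereal_sup [set (f b : R)%:E | f in dual_feasible c].

Definition sol_dual c b : set (dual Y) :=
  [set f | dual_feasible c f /\ (f b : R)%:E = val_dual c b].

Definition value_function c : Y -> \bar R :=
  fun y => ereal_inf [set (c x : R)%:E | x in [set x | P x /\ Q (A x - y)]].

Definition range_cone : set Y := [set A x - q | x in P & q in Q].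

End conic_programs.

(* Main.v *)
Require Import Defs.
From HB Require Import structures.
From mathcomp Require Import all_boot all_order all_algebra.
From mathcomp Require Import all_classical all_reals all_analysis.
From mathcomp Require Import ring lra.

Set Implicit Arguments.
Unset Strict Implicit.
Unset Printing Implicit Defensive.

Import Order.TTheory GRing.Theory Num.Theory.
Import numFieldNormedType.Exports.

Local Open Scope classical_set_scope.
Local Open Scope ring_scope.

(** Everything is read off the convex cone [epi] of the pairs (y, r) such that
some x in P satisfies Ax - y in Q and c x <= r: the value h y is the infimum of
the r with (y, r) in [epi], and a functional f is feasible for the dual problem
exactly when f y <= r on [epi] ([dual_feasibleP]).

Each of the four conditions says that h is bounded above near b, relatively to
the span Y0 of A(P) - Q. For the first two this is almost their wording. For the
other two, b in the intrinsic core makes the convex set of those u with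
h (b + u) <= M absorbing in Y0. When Y0 is finite-dimensional, every convex
absorbing set is a neighborhood of 0 ([finite_dimensional_convex_nbhs]), because
continuous functionals give coordinates on Y0. In the Frechet case it is a
consequence of the Robinson-Ursescu theorem on convex relations with closed
graph ([robinson_ursescu]), which rests on a Baire category argument
([barrel_nbhs]) and on successive approximations.

If h takes the value -oo somewhere, then by convexity it does so at each point of
the intrinsic core ([epi_icr_unbounded]), and the dual problem is infeasible.
Otherwise h b is real, and one separation argument yields everything. The upper
bound of h near b turns into an inequality
  h z - t (h b) + K s >= 0 whenever t b - z lies in s U,
for a convex neighborhood U of 0; a linear functional f below the sublinear
function encoded by this inequality is bounded on U, lies below h and agrees with
h at b ([subgradient_exists]). So f is a continuous subgradient and a dual
solution. Since h lies above f and is convex and bounded above near b, it is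
continuous at b ([value_continuous]). If Y0 is the whole space, the dual
solutions are uniformly bounded on U, hence form a weak-star closed part of a
Banach-Alaoglu compact set ([sol_dual_compact]). *)

(** * Linear functionals below a convex cone *)

Section hahn_banach.
Context {R : realType} {V : lmodType R}.
Implicit Types (S C : set (V * R^o)%type) (m : R).

Let pairZ (t : R) (x : V) (r : R) :
  t *: ((x, r) : V * R^o) = (t *: x, t * r). Proof. by []. Qed.

Let pairD (x y : V) (r s : R) :
  ((x, r) : V * R^o) + (y, s) = (x + y, r + s). Proof. by []. Qed.

Lemma convex_cone0 (W : lmodType R) (S : set W) : convex_cone S -> S 0.
Proof. by move=> [[x Sx] _ Sz]; rewrite -(scale0r x); exact: Sz. Qed.

(** A lower bound over the origin improves to 0, since the fibre of a cone over
    the origin is invariant under positive scaling. *)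
Lemma cone_ge0 S m : convex_cone S ->
  (forall r, S (0, r) -> m <= r) -> forall r, S (0, r) -> 0 <= r.
Proof.
move=> [_ _ Sz] Sm r Sr; rewrite leNgt; apply/negP => r0.
have t0 : 0 <= (`|m| + 1) / - r.
  by rewrite divr_ge0// ?oppr_ge0 ?(ltW r0)// addr_ge0.
have := Sz _ _ t0 Sr; rewrite pairZ scaler0 => /Sm.
rewrite invrN mulrN mulNr divfK ?lt_eqF// => mle.
by have := ler_norm (- m); rewrite normrN; lra.
Qed.

(** Zorn's lemma applied to cones instead of functionals: the union of a chain of
    cones is again one, so that no upper bound has to be constructed. *)
Lemma maximal_cone S m : convex_cone S -> (forall r, S (0, r) -> m <= r) ->
  exists C, [/\ convex_cone C, S `<=` C, forall r, C (0, r) -> 0 <= r &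
    forall D, convex_cone D -> C `<=` D -> (forall r, D (0, r) -> 0 <= r) ->
      D `<=` C].
Proof.
move=> cS Sm.
(* The union with [S] lets the empty chain be bounded as well. *)
pose good C := convex_cone (S `|` C) /\ forall r, (S `|` C) (0, r) -> 0 <= r.
have [|C [[cC C0] Cmax]] := @Zorn_bigcup _ good.
  move=> F Fgood Ftot; split.
    have [S0 SD SZ] := cS; split.
    - by have [x Sx] := S0; exists x; left.
    - suff key x y : (S `|` \bigcup_(B in F) B) x -> (S `|` \bigcup_(B in F) B) y ->
          (S x /\ S y) \/ exists2 B, F B & (S `|` B) x /\ (S `|` B) y.
        move=> x y /key /[apply] -[[/SD + /[dup] Sy]|[B FB [Bx By]]].
          by move=> /(_ _ Sy) ?; left.
        have [[_ + _] _] := Fgood _ FB; move=> /(_ _ _ Bx By) [?|?]; first by left.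
        by right; exists B.
      move=> [Sx|[B FB Bx]] [Sy|[B' FB' By]]; first by left.
      + by right; exists B' => //; split; [left|right].
      + by right; exists B => //; split; [right|left].
      + have [BB'|B'B] := Ftot _ _ FB FB'; right.
          by exists B' => //; split; right => //; exact: BB'.
        by exists B => //; split; right => //; exact: B'B.
    - move=> t x t0 [Sx|[B FB Bx]]; first by left; exact: SZ.
      have [[_ _ BZ] _] := Fgood _ FB.
      by have [|?] := BZ t x t0 (or_intror Bx); [left|right; exists B].
  move=> r [Sr|[B FB Br]]; first exact: (cone_ge0 cS Sm).
  by apply: (Fgood _ FB).2; right.
exists (S `|` C); split => // D cD CD D0 x Dx.
have SD : S `<=` D by move=> y ?; apply: CD; left.
apply: contrapT => nCx; apply: (Cmax (S `|` D)).
  split; first by move=> y ?; right; apply: CD; right.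
  by move=> /(_ x (or_intror Dx)) ?; apply: nCx; right.
by rewrite /good setUA setUid setUC (setUidl SD).
Qed.

(** The Hahn-Banach theorem, with a sublinear function replaced by a cone [S] that
    plays the role of its epigraph. A maximal cone [C] above [S] contains
    (z, - inf I z), where [inf I z] is the infimum of the fibre of [C] over -z,
    because adding this point keeps the fibre over 0 nonnegative. Hence each fibre
    of [C] contains its infimum, these infima are odd in z, and [C] is the epigraph
    of a linear functional. *)
Theorem cone_separation S m : convex_cone S -> (forall y, exists r, S (y, r)) ->
  (forall r, S (0, r) -> m <= r) ->
  exists2 f : V -> R^o, linear f & forall y r, S (y, r) -> f y <= r.
Proof.
move=> cS Stot /(maximal_cone cS)[C [cC SC C0 Cmax]].
have [_ CD CZ] := cC; have C00 := convex_cone0 cC.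
have Cle y r r' : C (y, r) -> C (- y, r') -> - r' <= r.
  move=> Cr Cr'; have := CD _ _ Cr Cr'; rewrite pairD subrr => /C0; lra.
have ex_val y : exists r : R, C (y, r) /\ C (- y, - r).
  pose I y := [set r | C (- y, r)].
  have infI z : has_inf (I z).
    split; first by have [r /SC] := Stot (- z); exists r.
    have [r /SC Cr] := Stot z; exists (- r) => r' /= Cr'.
    by apply: Cle Cr' _; rewrite opprK.
  have Ile z r : C (- z, r) -> inf (I z) <= r.
    by move=> Cr; apply: ge_inf => //; case: (infI z).
  suff Cinf z : C (z, - inf (I z)).
    exists (- inf (I y)); split=> //; rewrite opprK.
    suff -> : inf (I y) = - inf (I (- y)) by [].
    apply/le_anti/andP; split; first exact: Ile.
    apply: lb_le_inf => [|r' Cr']; first by case: (infI y).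
    rewrite lerNl; apply: lb_le_inf => [|r]; first by case: (infI (- y)).
    by rewrite /I/= opprK => Cr; exact: Cle Cr Cr'.
  (* The cone generated by [C] and the point to be added. *)
  pose D := [set x : (V * R^o)%type |
    exists x0 t, [/\ C x0, 0 <= t & x = x0 + t *: (z, - inf (I z))]].
  apply: (Cmax D); last 1 first.
  - by exists 0, 1; split => //; rewrite scale1r add0r.
  - split; first by exists 0, 0, 0; split => //; rewrite scale0r addr0.
    + move=> _ _ [u [t [Cu t0 ->]]] [u' [t' [Cu' t'0 ->]]].
      exists (u + u'), (t + t'); split; [exact: CD|exact: addr_ge0|].
      by rewrite scalerDl addrACA.
    + move=> a _ a0 [u [t [Cu t0 ->]]].
      exists (a *: u), (a * t); split; [exact: CZ|exact: mulr_ge0|].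
      by rewrite scalerDr scalerA.
  - by move=> u Cu; exists u, 0; split => //; rewrite scale0r addr0.
  - move=> r [[u s] [t [Cu t0]]]; rewrite pairZ pairD => -[uE ->].
    move: t0; rewrite le_eqVlt => /orP[/eqP t0|t0].
      move: uE; rewrite -t0 !scale0r !addr0 => uE; apply: C0.
      by rewrite mul0r addr0 uE.
    have uz : u = t *: - z by rewrite scalerN; apply/eqP; rewrite -addr_eq0 -uE.
    have /(CZ _ _ (ltW (_ : 0 < t^-1))) := Cu.
    rewrite invr_gt0 => /(_ t0).
    rewrite pairZ uz scalerA mulVf ?gt_eqF// scale1r => /Ile.
    rewrite mulrC ler_pdivlMr// mulrN; lra.
have [f Cf] := choice ex_val.
have fle y r : C (y, r) -> f y <= r.
  by move=> Cr; have := Cle _ _ _ Cr (Cf y).2; rewrite opprK.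
exists f; last by move=> y r /SC; exact: fle.
move=> a x y.
have CfZ b z : C (b *: z, b *: f z).
  have [b0|/ltW b0] := leP 0 b; first exact: (CZ _ _ b0 (Cf z).1).
  have := CZ (- b) _ _ (Cf z).2; rewrite oppr_ge0 => /(_ b0).
  by rewrite pairZ scalerN scaleNr opprK mulrNN.
apply/le_anti/andP; split.
  by apply: fle; exact: (CD _ _ (CfZ a x) (Cf y).1).
have := CD _ _ (CfZ (- a) x) (Cf y).2.
rewrite pairD !scaleNr -!opprD => /(Cle _ _ _ (Cf (a *: x + y)).1).
by rewrite opprK.
Qed.
End hahn_banach.

(** * Separation in locally convex spaces *)

(** The parameter is a plain scalar, so that field arithmetic applies to it. *)
Definition convex {R : realType} {V : lmodType R} (U : set V) :=
  forall (t : R) x y, 0 <= t <= 1 -> U x -> U y -> U (t *: x + (1 - t) *: y).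

Section locally_convex.
Context {R : realType} {E : tvsType R}.
Implicit Types (U : set E) (x : E).

Lemma nbhs0_affine U (a : R) x : nbhs 0 U -> \forall y \near x, U (a *: (y - x)).
Proof.
move=> U0; suff : a *: (y - x) @[y --> x] --> (0 : E) by apply.
rewrite -[X in _ --> X](scaler0 _ a) -[in X in _ --> X](subrr x).
apply: (@continuous_comp _ (R^o * E)%type _ (fun y => (a, y - x))
  (fun z => z.1 *: z.2)); last exact: scale_continuous.
apply: (@cvg_pair _ _ _ _ (nbhs (a : R^o))); first exact: cvg_cst.
apply: (@continuous_comp _ _ _ (fun y => (y, x)) (fun z : E * E => z.1 - z.2)).
  by apply: cvg_pair; [exact: cvg_id|exact: cvg_cst].
exact: sub_continuous.
Qed.

Lemma nbhs0_absorbing U x : nbhs 0 U ->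
  exists2 d : R, 0 < d & forall t, `|t| <= d -> U (t *: x).
Proof.
move=> U0; suff /(_ _ U0)/nbhs_closedballP[d dU] :
    t *: x @[t --> (0 : R^o)] --> (0 : E).
  exists d%:num => // t td; apply: dU.
  by rewrite closed_ballE// /closed_ball_/= sub0r normrN.
rewrite -[X in _ --> X](scale0r x).
apply: (@continuous_comp R^o (R^o * E)%type _ (fun t => (t, x))
  (fun z => z.1 *: z.2)); last exact: scale_continuous.
by apply: (@cvg_pair _ _ _ _ (nbhs (0 : R^o))); [exact: cvg_id|exact: cvg_cst].
Qed.

Lemma nbhs_translate U x : nbhs x U -> nbhs 0 [set u | U (x + u)].
Proof.
move=> /(nbhsB (- x)); rewrite addNr; apply: filterS => _ [y Uy <-] /=.
by rewrite addrA subrr add0r.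
Qed.

Lemma convex_nbhs0 U : nbhs 0 U -> exists W,
  [/\ nbhs 0 W, W `<=` U, convex W & forall x, W x -> W (- x)].
Proof.
have [B Bconv [Bopen Bnbhs]] := @locally_convex R E.
move=> /Bnbhs[W [BW W0] WU].
have W0' : nbhs 0 W by apply: open_nbhs_nbhs; split => //; exact: Bopen.
have cW : convex W.
  move=> t x y /andP[t0 t1] Wx Wy; apply/set_mem.
  exact: (Bconv W (mem_set BW) x y (Itv01 t0 t1) (mem_set Wx) (mem_set Wy)).
exists (W `&` -%R @^-1` W); split.
- apply: filterI => //.
  by apply: filterS (nbhs0_affine (-1) 0 W0') => x; rewrite subr0 scaleN1r.
- by move=> x [/WU].
- move=> t x y t01 [Wx Wx'] [Wy Wy']; split; first exact: cW.
  by rewrite /= opprD -!scalerN; exact: cW.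
- by move=> x [Wx Wx']; split=> //=; rewrite opprK.
Qed.

(** A one-sided bound on [U] is two-sided on a symmetric smaller neighborhood, and
    shrinking that neighborhood shrinks the bound. *)
Lemma linear_bounded_nbhs_continuous (f : E -> R^o) U (K : R) : linear f ->
  nbhs 0 U -> (forall u, U u -> f u <= K) -> continuous f.
Proof.
move=> lf U0 fK x.
pose g : {linear E -> R^o} := HB.pack f (GRing.isLinear.Build R E R^o *:%R f lf).
have fZ (a : R) y : f (a *: y) = a * f y := linearZZ g a y.
have fB y z : f (y - z) = f y - f z := linearB g y z.
have fN y : f (- y) = - f y := linearN g y.
have [W [W0 WU _ WN]] := convex_nbhs0 U0.
have K0 : 0 <= K.
  by apply: le_trans (fK 0 _); [rewrite -[f 0]/(g 0) linear0|exact: nbhs_singleton].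
apply/cvgrPdist_lt => e e0.
have K1 : 0 < K + 1 by lra.
apply: filterS (nbhs0_affine ((K + 1) / e) x W0) => y Wy.
have yx : (K + 1) / e * (f y - f x) <= K by rewrite -fB -fZ; apply/fK/WU.
have xy : - ((K + 1) / e * (f y - f x)) <= K.
  by rewrite -fB -fZ -fN; apply/fK/WU/WN.
have : `|(K + 1) / e * (f y - f x)| < K + 1.
  by apply: (@le_lt_trans _ _ K); [rewrite ler_norml lerNl xy|lra].
rewrite normrM gtr0_norm ?divr_gt0// -mulrA -ltr_pdivlMl// mulVf ?gt_eqF//.
by rewrite mulrC ltr_pdivrMr// mul1r distrC.
Qed.

Lemma convex_sumZ U (s t : R) x y : convex U -> 0 <= s -> 0 <= t ->
  U x -> U y -> exists2 u, U u & s *: x + t *: y = (s + t) *: u.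
Proof.
move=> cU s0 t0 Ux Uy.
have [st0|st0] := eqVneq (s + t) 0.
  exists x => //; have [-> ->] : s = 0 /\ t = 0 by split; lra.
  by rewrite addr0 !scale0r addr0.
have st_gt0 : 0 < s + t by rewrite lt_neqAle eq_sym st0 addr_ge0.
exists (s / (s + t) *: x + (1 - s / (s + t)) *: y).
  by apply: cU => //; rewrite divr_ge0 ?(ltW st_gt0)//= ler_pdivrMr// mul1r; lra.
rewrite scalerDr !scalerA mulrCA mulfV// mulr1; congr (_ + _ *: _).
by field.
Qed.

(** Adding to [S] the cone generated by U x {K} forces the separating functional to
    be at most K on [U], hence continuous, and makes all fibres nonempty because
    [U] is absorbing. The hypothesis says that the fibre over 0 of the
    enlarged cone remains bounded below. *)
Theorem continuous_separation (S : set (E * R^o)%type) U (K m : R) :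
  convex_cone S -> nbhs 0 U -> convex U ->
  (forall z r s u, S (z, r) -> 0 <= s -> U u -> z + s *: u = 0 ->
    m <= r + s * K) ->
  exists f : dual E, forall z r, S (z, r) -> f z <= r.
Proof.
move=> cS U0 cU SU; have [_ SD SZ] := cS; have S0 := convex_cone0 cS.
have U00 : U 0 := nbhs_singleton U0.
pose T := [set z : (E * R^o)%type | exists z0 s u, [/\ S z0, 0 <= s, U u &
  z = z0 + s *: (u, K)]].
have TU s u : 0 <= s -> U u -> T (s *: (u, K)).
  by move=> s0 Uu; exists 0, s, u; split=> //; rewrite add0r.
have TS z : S z -> T z.
  by move=> Sz; exists z, 0, 0; split=> //; rewrite scale0r addr0.
have cT : convex_cone T.
  split; first by exists 0; exact: TS.
    move=> _ _ [z [s [u [Sz s0 Uu ->]]]] [z' [s' [u' [Sz' s'0 Uu' ->]]]].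
    have [v Uv vE] := convex_sumZ cU s0 s'0 Uu Uu'.
    exists (z + z'), (s + s'), v; split; [exact: SD|exact: addr_ge0| by []|].
    rewrite addrACA; congr (_ + _); rewrite -[RHS]/((_, _)) -[LHS]/((_, _)).
    by congr (_, _); [exact: vE|rewrite -scalerDl].
  move=> a _ a0 [z [s [u [Sz s0 Uu ->]]]].
  exists (a *: z), (a * s), u; split; [exact: SZ|exact: mulr_ge0|by []|].
  by rewrite scalerDr scalerA.
have [y|r|f lf Tf] := @cone_separation _ _ T m cT.
- have [d d0 /(_ d)] := nbhs0_absorbing y U0.
  rewrite gtr0_norm// => /(_ (lexx _))/(TU d^-1).
  rewrite invr_ge0 ltW// => /(_ isT) TUy; exists (d^-1 * K).
  by rewrite -[y]scale1r -(mulVf (lt0r_neq0 d0)) -scalerA.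
- move=> [[z r'] [s [u [Sz s0 Uu]]]] -[zE ->]; exact: (SU _ _ _ _ Sz s0 Uu).
have fU u : U u -> f u <= K.
  by move=> Uu; apply: Tf; rewrite -(scale1r (u, _)); exact: TU.
have fP : f \in @clin_pred R E R^o.
  by rewrite inE; split => //; exact: linear_bounded_nbhs_continuous fU.
by exists (Clin fP) => z r /TS /Tf.
Qed.

End locally_convex.

Section separation_consequences.
Context {R : realType} {E : tvsType R}.

(** The cone generated by (-v, -1) is separated using a neighborhood of 0 that
    omits [v]. *)
Lemma dual_separates (v : E) : hausdorff_space E -> v != 0 ->
  exists f : dual E, f v = 1.
Proof.
move=> hE v0.
have Uv : nbhs (0 : E) (~` [set v]).
  apply: open_nbhs_nbhs; split; last by move=> /= /esym/eqP; apply/negP.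
  by apply: closed_openC; apply: accessible_closed_set1; exact: hausdorff_accessible.
have [U [U0 Uv' cU _]] := convex_nbhs0 Uv.
pose S := [set z : (E * R^o)%type | exists2 t : R, 0 <= t & z = - t *: (v, 1)].
have cS : convex_cone S.
  split; first by exists 0, 0 => //; rewrite oppr0 scale0r.
    move=> _ _ [s s0 ->] [t t0 ->]; exists (s + t); first exact: addr_ge0.
    by rewrite -scalerDl opprD.
  move=> a _ a0 [t t0 ->]; exists (a * t); first exact: mulr_ge0.
  by rewrite scalerA mulrN.
have [|f Sf] := @continuous_separation _ _ S U 1 0 cS U0 cU.
  move=> _ _ s u [t t0 [-> ->]] s0 Uu; rewrite scaleNr addrC => /eqP.
  rewrite subr_eq0 -[_%:A]/(- t * 1) !mulr1 => /eqP sutv; rewrite leNgt; apply/negP => st.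
  have t_gt0 : 0 < t by lra.
  apply: (Uv' ((s / t) *: u + (1 - s / t) *: 0)).
    apply: cU => //; last exact: nbhs_singleton.
    by rewrite divr_ge0//= ler_pdivrMr// mul1r; lra.
  rewrite scaler0 addr0 mulrC -scalerA sutv scalerA mulVf ?scale1r//.
  by rewrite gt_eqF.
have fv : 1 <= f v.
  have : f (- v) <= - 1.
    by apply: Sf; exists 1 => //; congr (_, _); rewrite ?scaleN1r// mulr1.
  by rewrite linearN lerN2.
exists ((f v)^-1 *: f); rewrite -[LHS]/((f v)^-1 * f v) mulVf// gt_eqF//.
exact: lt_le_trans fv.
Qed.

(** Here [S] is a cone of points above a sublinear function h with h b >= v, and
    [M] bounds h near [b]. Adding the ray through (-b, -v) to [S] forces f b >= v.
    The enlarged cone is separable with K = M - v: if z - t b + s u = 0, then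
    z + s (b + u) + b = (1 + s + t) b, so h at this point is at most
    r + s M + M for (z, r) in [S], and it is at least (1 + s + t) v. *)
Theorem subgradient_exists (S : set (E * R^o)%type) (L : set E) b (M v : R) :
  convex_cone S -> linear_subspace L -> (forall y r, S (y, r) -> L y) -> L b ->
  (\forall y \near b, L y -> S (y, M)) -> (forall r, S (b, r) -> v <= r) ->
  exists2 f : dual E, forall y r, S (y, r) -> f y <= r & v <= f b.
Proof.
move=> cS [L0 LD] SL Lb SM vS; have [_ SD SZ] := cS.
have S00 : S 0 := convex_cone0 cS.
have [U [U0 UM cU _]] := convex_nbhs0 (nbhs_translate SM).
have Sb : S (b, M) by apply: (nbhs_singleton SM).
pose T := [set z : (E * R^o)%type | exists z0 t, [/\ S z0, 0 <= t &
  z = z0 - t *: (b, v)]].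
have cT : convex_cone T.
  split.
  - by exists 0, 0, 0; split => //; rewrite scale0r subr0.
  - move=> _ _ [z [t [Sz t0 ->]]] [z' [t' [Sz' t'0 ->]]].
    exists (z + z'), (t + t'); split; [exact: SD|exact: addr_ge0|].
    by rewrite scalerDl opprD addrACA.
  - move=> a _ a0 [z [t [Sz t0 ->]]].
    exists (a *: z), (a * t); split; [exact: SZ|exact: mulr_ge0|].
    by rewrite scalerBr scalerA.
have [|f Tf] := @continuous_separation _ _ T U (M - v) (v - M) cT U0 cU.
  move=> _ _ s u [[z r] [t [Sz t0 [-> ->]]]] s0 Uu zE.
  have zE' : z + s *: u = t *: b.
    by apply/eqP; rewrite -subr_eq0 addrAC; exact/eqP.
  have Su : S (s *: (b + u), s * M).
    move: s0; rewrite le_eqVlt => /orP[/eqP<-|s0].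
      by rewrite scale0r mul0r; exact: S00.
    apply: (SZ s (b + u, M) (ltW s0)); apply: UM => //.
    have -> : b + u = s^-1 *: (t *: b - z) + b.
      rewrite -zE' addrC addrAC subrr add0r scalerA mulVf ?gt_eqF// scale1r.
      by rewrite addrC.
    apply: (LD) => //; rewrite addrC -scaleN1r; apply: (LD); first exact: SL Sz.
    by rewrite -[_ *: b]addr0; exact: LD.
  have := SD _ _ Sb (SD _ _ Sz Su).
  rewrite -[_ + _]/((b + (z + s *: (b + u)), M + (r + s * M))).
  have -> : b + (z + s *: (b + u)) = (1 + s + t) *: b.
    by rewrite scalerDr [z + _]addrCA zE' addrA !scalerDl scale1r.
  have st0 : 0 < 1 + s + t by lra.
  move=> /(SZ (1 + s + t)^-1 _ (ltW _)); rewrite invr_gt0 => /(_ st0).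
  rewrite -[_ *: _]/((_ *: _, _ * _)) scalerA mulVf ?gt_eqF// scale1r => /vS.
  by rewrite ler_pdivlMl// -[X in r - X]/(t * v) /=; lra.
exists f => [y r Sy|].
  by apply: Tf; exists (y, r), 0; split => //; rewrite scale0r subr0.
rewrite -lerN2 -linearN; apply: Tf; exists 0, 1; split => //.
by rewrite scale1r sub0r.
Qed.

End separation_consequences.

(** * Convex sets and relations in Frechet spaces *)

Section complete_metric.
Context {R : realType} {E : tvsType R} (d : E -> E -> R).
Context (dxx : forall x, d x x = 0) (dC : forall x y, d x y = d y x)
  (dD : forall x y z, d x z <= d x y + d y z)
  (nbhs_d : forall x, nbhs x =
    filter_from [set e : R | 0 < e] (fun e => [set y | d x y < e]))
  (complete_d : forall u : nat -> E,
    (forall e : R, 0 < e -> exists N : nat, forall m n : nat,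
      (N <= m)%N -> (N <= n)%N -> d (u m) (u n) < e) ->
    exists l : E, u n @[n --> \oo] --> l).

(** The closed balls around [u n] of radius [r n] decrease, so that their centers
    converge to a common point; this serves both the Baire category argument and
    the convergence of a rapidly decreasing series. *)
Lemma nested_balls (u : nat -> E) (r : nat -> R) : (forall n, 0 <= r n) ->
  (forall n, d (u n) (u n.+1) + r n.+1 <= r n) ->
  (forall e, 0 < e -> exists n, r n < e) ->
  exists2 l, u n @[n --> \oo] --> l & forall n, d (u n) l <= r n.
Proof.
move=> r0 ur r_small.
have udist k n : d (u n) (u (n + k)%N) <= r n.
  elim: k n => [|k IH] n; first by rewrite addn0 dxx.
  rewrite (le_trans (dD _ (u n.+1) _))// (le_trans _ (ur n))// lerD2l.
  by rewrite -addSnnS; exact: IH.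
have [|l ul] := complete_d (u := u).
  move=> e e0; have [|N rN] := r_small (e / 2); first by rewrite divr_gt0.
  exists N => m n Nm Nn; rewrite (le_lt_trans (dD _ (u N) _))// dC.
  have := udist (m - N)%N N; have := udist (n - N)%N N; rewrite !subnKC//; lra.
exists l => // n; apply/ler_addgt0Pr => e e0.
have : nbhs l [set y | d l y < e] by rewrite nbhs_d; exists e.
move=> /ul[N _ /(_ (n + N)%N (leq_addl _ _))/= lN].
rewrite (le_trans (dD _ (u (n + N)%N) _))//.
by apply: lerD; [exact: udist|rewrite dC ltW].
Qed.

Lemma exists_pow_lt (a e : R) : 0 < e -> exists n, a * 2^-1 ^+ n < e.
Proof.
move=> e0; have : a * 2^-1 ^+ n @[n --> \oo] --> a * 0.
  apply: cvgM; first exact: cvg_cst.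
  by apply: cvg_expr; rewrite ger0_norm// invf_lt1// ltr1n.
rewrite mulr0 => /cvgrPdist_lt/(_ _ e0)[N _ /(_ N (leqnn _))/=].
by rewrite sub0r normrN => h; exists N; exact: le_lt_trans (ler_norm _) h.
Qed.

(** Baire's argument. If [B] is not a relative neighborhood of 0, then no multiple
    of [B] contains a relative ball of [L]: from a ball around y inside N B, the
    segment towards a point of [B] on the ray of -y leads to a ball around 0 inside
    [B]. Nested balls then avoid all multiples of [B] in turn, although the
    absorbing set [B] has a multiple that contains their common point. *)
Theorem barrel_nbhs (L B : set E) : linear_subspace L -> closed L ->
  closed B -> convex B -> (forall y, L y -> exists2 t : R, 0 < t & B (t *: y)) ->
  \forall y \near 0, L y -> B y.
Proof.
move=> [L0 LD] cL clB cB absB.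
have LZ (a : R) x : L x -> L (a *: x) by move=> Lx; rewrite -[_ *: _]addr0; exact: LD.
have B0 : B 0 by have [t _] := absB _ L0; rewrite scaler0.
apply: contrapT => nB.
have outside n y r : L y -> 0 < r -> exists y', L y' /\ (d y y' < r / 2 /\
    ~ B (n.+1%:R^-1 *: y')).
  move=> Ly r0; apply: contrapT => /forallNP yB; apply: nB.
  have {}yB y' : L y' -> d y y' < r / 2 -> B (n.+1%:R^-1 *: y').
    by move=> Ly' yy'; apply: contrapT => ?; apply: (yB y').
  have [|t t0 Bt] := absB (- y); first by rewrite -scaleN1r; exact: LZ.
  set N : R := n.+1%:R; have N0 : 0 < N by rewrite ltr0n.
  have tN : 0 < t + N^-1 by rewrite addr_gt0 ?invr_gt0.
  (* The weight for which the segment from y / N to - t y passes through 0. *)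
  pose a := t / (t + N^-1); have a0 : 0 < a by rewrite divr_gt0.
  have : nbhs y [set y' | d y y' < r / 2].
    by rewrite nbhs_d; exists (r / 2) => //=; rewrite divr_gt0.
  move=> /nbhs_translate/(nbhs0_affine (N / a) 0); apply: filterS => z /= zy Lz.
  rewrite subr0 in zy.
  have Lyz : L (y + (N / a) *: z) by rewrite addrC; exact: LD.
  have /cB/(_ Bt) := yB _ Lyz zy; move=> /(_ a); rewrite (ltW a0)/=.
  rewrite ler_pdivrMr// mul1r lerDl invr_ge0 (ltW N0) => /(_ isT).
  rewrite !scalerN !scalerA scalerDr scalerA addrAC -scalerBl.
  have aN : a * (t + N^-1) = t by rewrite divfK// gt_eqF.
  have -> : a * N^-1 - (1 - a) * t = 0.
    by rewrite mulrBl mul1r opprB addrA -mulrDr [N^-1 + t]addrC aN subrr.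
  have -> : a * N^-1 * (N / a) = 1 by rewrite mulrA divfK ?mulfV ?gt_eqF.
  by rewrite scale0r scale1r add0r.
(* The radius is halved both to keep the closed ball inside the complement and to
   let the radii tend to 0. *)
have step (nyr : nat * (E * R)) : exists y'r' : E * R, L nyr.2.1 -> 0 < nyr.2.2 ->
    [/\ L y'r'.1, 0 < y'r'.2, d nyr.2.1 y'r'.1 + y'r'.2 <= nyr.2.2,
      y'r'.2 <= nyr.2.2 / 2 &
      forall z, d y'r'.1 z <= y'r'.2 -> ~ B (nyr.1.+1%:R^-1 *: z)].
  case: nyr => n [y r] /=; have [[Ly r0]|nyr] := pselect (L y /\ 0 < r); last first.
    by exists (y, r) => ? ?; exfalso; apply: nyr.
  have [y' [Ly' [yy' nBy']]] := outside n y r Ly r0.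
  have : nbhs y' (~` [set z | B (n.+1%:R^-1 *: z)]).
    apply: open_nbhs_nbhs; split=> //; apply: closed_openC.
    have cont : continuous (fun z : E => n.+1%:R^-1 *: z).
      move=> z; apply: (@continuous_comp _ (R^o * E)%type _ (fun y => (_, y))
        (fun z => z.1 *: z.2)); last exact: scale_continuous.
      apply: (@cvg_pair _ _ _ _ (nbhs (n.+1%:R^-1 : R^o))); first exact: cvg_cst.
      exact: cvg_id.
    by move: clB; apply: (continuous_closedP _).1.
  rewrite nbhs_d => -[e /= e0 eB].
  exists (y', Num.min (e / 2) (r / 2)) => _ _ /=; split => //.
  - by rewrite lt_min !divr_gt0.
  - have : Num.min (e / 2) (r / 2) <= r / 2 by rewrite ge_min lexx orbT.
    lra.
  - by rewrite ge_min lexx orbT.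
  - move=> z; rewrite le_min => /andP[ze _]; apply: eB => /=.
    by rewrite (le_lt_trans ze)// ltr_pdivrMr// ltr_pMr// ltr1n.
have [f fP] := choice step.
pose st := fix st n := if n is m.+1 then f (m, st m) else (0 : E, 1 : R).
have stP n : L (st n).1 /\ 0 < (st n).2.
  by elim: n => [|n [Ln rn]] //=; have [] := fP (n, st n) Ln rn.
have stS n := fP (n, st n) (stP n).1 (stP n).2.
have [||e e0|l ul dl] := @nested_balls (fun n => (st n).1) (fun n => (st n).2).
- by move=> n; exact/ltW/(stP n).2.
- by move=> n; have [] := stS n.
- have [n] := exists_pow_lt 1 e0; rewrite mul1r => ne; exists n.
  apply: le_lt_trans ne; elim: n => [|n IH]; first by rewrite expr0.
  by have [_ _ _ /= h _] := stS n; rewrite (le_trans h)// exprSr ler_pM2r.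
have Ll : L l.
  apply: (@closed_cvg _ _ \oo eventually_filter (fun n => (st n).1)) => //.
  by apply: nearW => n; exact: (stP n).1.
have [t t0 Bt] := absB _ Ll.
have [n tn] : exists n, t^-1 < n.+1%:R by exists (Num.truncn t^-1); exact: truncnS_gt.
have [_ _ _ _ /(_ l (dl n.+1))] := stS n; apply.
have /(_ (n.+1%:R^-1 / t)) := cB _ _ _ _ Bt B0.
rewrite scaler0 addr0 scalerA divfK ?gt_eqF//; apply.
rewrite divr_ge0 ?(ltW t0)//= ler_pdivrMr// mul1r.
by rewrite -[leRHS]invrK lef_pV2 ?posrE ?invr_gt0// ltW.
Qed.

End complete_metric.

Lemma convex_closure {R : realType} {E : tvsType R} (U : set E) :
  convex U -> convex (closure U).
Proof.
move=> cU t x y t01 clx cly N nN.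
have [W [W0 WN cW _]] := convex_nbhs0 (nbhs_translate nN).
have [x' [Ux' Wx']] := clx _ (nbhs0_affine 1 x W0).
have [y' [Uy' Wy']] := cly _ (nbhs0_affine 1 y W0).
exists (t *: x' + (1 - t) *: y'); split; first exact: cU.
have := WN _ (cW t _ _ t01 Wx' Wy'); rewrite /= !scale1r !scalerBr.
by rewrite [t *: x' - _ + _]addrACA -opprD addrCA subrr addr0.
Qed.

(** The Robinson-Ursescu theorem at the origin. For a neighborhood [U] of 0 in [X],
    the closure of the image of [U] under [G] is convex and absorbing in [L], hence a
    relative neighborhood of 0 by [barrel_nbhs]. To remove the closure, expand
    y = \sum_k 2^-(k+1) y_k with pairs (x_k, y_k) in [G], where x_k is chosen so
    small that x = \sum_k 2^-(k+1) x_k converges inside [V]. The partial sums are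
    convex combinations of points of [G] and 0, so the limit (x, y) lies in the
    closed set [G]. *)
Theorem robinson_ursescu {R : realType} {X Y : tvsType R} (L : set Y)
    (G : set (X * Y)%type) (V : set X) :
  frechet_space X -> frechet_space Y -> linear_subspace L -> closed L ->
  closed G -> convex G -> G 0 -> (forall z, G z -> L z.2) ->
  (forall y, L y -> exists2 t : R, 0 < t & exists x, G (x, t *: y)) ->
  nbhs 0 V ->
  \forall y \near 0, L y -> exists2 x, V x & G (x, y).
Proof.
move=> [dX [[dX0 dXC dXD] dXT nbhsX cX]] [dY [[dY0 dYC dYD] dYT nbhsY cY]].
move=> sL cL cG convG G0 GL absG V0; have [L0 LD] := sL.
have dXxx x : dX x x = 0 by exact/dX0.
have dYxx y : dY y y = 0 by exact/dY0.
have almost_open U : nbhs 0 U ->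
    \forall y \near 0, L y -> closure [set y | exists2 x, U x & G (x, y)] y.
  move=> U0; have [W [W0 WU cW _]] := convex_nbhs0 U0.
  suff : \forall y \near 0, L y -> closure [set y | exists2 x, W x & G (x, y)] y.
    apply: filterS => y /[apply]; apply: closureS => z [x /WU Ux Gx].
    by exists x.
  apply: (barrel_nbhs dYxx dYC dYD nbhsY cY) => //; first exact: closed_closure.
    apply: convex_closure => t y z t01 [x Wx Gxy] [x' Wx' Gxz].
    by exists (t *: x + (1 - t) *: x'); [exact: cW|exact: (convG _ _ _ t01 Gxy Gxz)].
  move=> y /absG[t t0 [x Gx]]; have [e e0 We] := nbhs0_absorbing x W0.
  have m0 : 0 < Num.min e 1 by rewrite lt_min e0 ltr01.
  exists (Num.min e 1 * t); first exact: mulr_gt0.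
  apply: subset_closure; exists (Num.min e 1 *: x).
    by apply: We; rewrite gtr0_norm// ge_min lexx.
  have /(_ (Num.min e 1)) := convG _ _ _ _ Gx G0.
  rewrite scaler0 addr0 (ltW m0) ge_min lexx orbT => /(_ isT).
  by rewrite -[_ *: _]/((_ *: _, _ *: _)) scalerA.
move: V0; rewrite nbhsX => -[rho /= rho0 rhoV].
have /choice[W WP] n : exists W : set X, [/\ nbhs 0 W, convex W &
    W `<=` [set x | dX 0 x < rho * 2^-1 ^+ n.+2]].
  have Wn : nbhs (0 : X) [set x | dX 0 x < rho * 2^-1 ^+ n.+2].
    by rewrite nbhsX; exists (rho * 2^-1 ^+ n.+2) => //=; rewrite mulr_gt0// exprn_gt0.
  by have [W [? ? ? _]] := convex_nbhs0 Wn; exists W.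
have /choice[N NP] n : exists N : set Y, [/\ nbhs 0 N, convex N,
    N `<=` [set y | dY 0 y < 2^-1 ^+ n] &
    N `<=` [set y | L y -> closure [set y | exists2 x, W n x & G (x, y)] y]].
  have [W0 _ _] := WP n.
  have N0 : nbhs (0 : Y) [set y | dY 0 y < 2^-1 ^+ n].
    by rewrite nbhsY; exists (2^-1 ^+ n) => //=; rewrite exprn_gt0.
  have [M [M0 MN cM _]] := convex_nbhs0 (filterI N0 (almost_open _ W0)).
  by exists M; split => // y /MN[].
have /choice[F FP] (nr : nat * Y) : exists z : X * Y, L nr.2 -> N nr.1 (2 *: nr.2) ->
    [/\ W nr.1 z.1, G z & N nr.1.+1 (2 *: (2 *: nr.2 - z.2))].
  case: nr => n r /=; have [[Lr Nr]|nLN] := pselect (L r /\ N n (2 *: r)); last first.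
    by exists 0 => ? ?; exfalso; apply: nLN.
  have [_ _ _ /(_ _ Nr) clr] := NP n.
  have [N0 _ _ _] := NP n.+1.
  have Lr2 : L (2 *: r) by rewrite -[_ *: _]addr0; exact: LD.
  have [y [[x Wx Gx]]] := clr Lr2 _ (nbhs0_affine (- 2) (2 *: r) N0).
  rewrite /= scaleNr -scalerN opprB => Ny.
  by exists (x, y).
have [N00 _ _ _] := NP 0%N; have := nbhs0_affine 2 0 N00.
apply: filterS => y; rewrite /= subr0 => N0y Ly.
(* [r n] is the residual after [n] terms, magnified by 2 ^ n. *)
pose r := fix r n := if n is m.+1 then 2 *: r m - (F (m, r m)).2 else y.
have rP n : L (r n) /\ N n (2 *: r n).
  elim: n => [//|n [Lr Nr]]; have [_ /GL /= LF NF] := FP (n, r n) Lr Nr.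
  split => //=; rewrite addrC -scaleN1r; apply: (LD) => //.
  by rewrite -[_ *: _]addr0; exact: LD.
pose g n := F (n, r n); have gP n := FP (n, r n) (rP n).1 (rP n).2.
pose s n := \sum_(k < n) 2^-1 ^+ k.+1 *: g k.
have sS n : s n.+1 = s n + 2^-1 ^+ n.+1 *: g n by rewrite /s big_ord_recr.
have halfK (Z : lmodType R) (z : Z) n : 2^-1 ^+ n.+1 *: (2 *: z) = 2^-1 ^+ n *: z.
  by rewrite scalerA exprSr mulfVK.
have ys n : y = (s n).2 + 2^-1 ^+ n *: r n.
  elim: n => [|n IH]; first by rewrite /s big_ord0 expr0 scale1r add0r.
  rewrite sS [r n.+1]/= scalerBr halfK {1}IH -[(_ + _).2]/((s n).2 + _ *: (g n).2).
  by rewrite -addrA; congr (_ + _); rewrite addrC subrK.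
(* The weights 2^-1, ..., 2^-n, 2^-n add up to 1; [z] will be 0, but a general [z]
   makes the induction work, its weight being split into two halves. *)
have Gs n z : G z -> G (s n + 2^-1 ^+ n *: z).
  elim: n z => [|n IH] z Gz; first by rewrite /s big_ord0 expr0 scale1r add0r.
  have [_ Gg _] := gP n.
  have h : 0 <= (2^-1 : R) <= 1 by rewrite invr_ge0 ler0n invf_le1// ler1n.
  have := IH _ (convG _ _ _ h Gg Gz); rewrite scalerDr !scalerA -exprSr addrA -sS.
  have -> : 1 - 2^-1 = 2^-1 :> R by lra.
  by rewrite -exprSr.
have small (Z : lmodType R) (U : set Z) (z : Z) n : convex U -> U 0 -> U z ->
    U (2^-1 ^+ n *: z).
  move=> cU U0 Uz; have := cU (2^-1 ^+ n) _ _ _ Uz U0.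
  rewrite scaler0 addr0; apply; rewrite exprn_ge0//= exprn_ile1//.
  by rewrite invf_le1// ler1n.
have [|n|e e0|l ul dl] := @nested_balls _ _ _ dXxx dXC dXD nbhsX cX
    (fun n => (s n).1) (fun n => rho * 2^-1 ^+ n.+1).
- by move=> n; rewrite mulr_ge0 ?exprn_ge0 ?ltW.
- have [W0 cW /(_ (2^-1 ^+ n.+1 *: (g n).1))/=] := WP n.
  have [Wg _ _] := gP n; move=> /(_ (small _ _ _ _ cW (nbhs_singleton W0) Wg)).
  rewrite -(dXT _ _ (s n).1) add0r addrC => Wd.
  rewrite sS -[(_ + _).1]/((s n).1 + _ *: (g n).1).
  by move: Wd; rewrite !exprS; lra.
- have [n ne] := exists_pow_lt rho e0; exists n; apply: le_lt_trans ne.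
  by rewrite ler_pM2l// exprS ler_piMl ?exprn_ge0// invf_le1// ler1n.
have sy : (s n).2 @[n --> \oo] --> y.
  move=> M; rewrite [nbhs y]nbhsY => -[e /= e0 eM].
  have [n0] := exists_pow_lt 1 e0; rewrite mul1r => n0e.
  exists n0 => // n /= n0n; apply: eM => /=; rewrite {1}(ys n).
  have -> : dY ((s n).2 + 2^-1 ^+ n *: r n) (s n).2 =
      dY 0 (2^-1 ^+ n *: r n).
    by rewrite dYC -{1}(add0r (s n).2) [_ + _ *: r n]addrC dYT.
  have [N0 cN /(_ (2^-1 ^+ n.+1 *: (2 *: r n))) h _] := NP n; move: h => /=.
  move=> /(_ (small _ _ _ _ cN (nbhs_singleton N0) (rP n).2)); rewrite halfK.
  move=> h; apply: lt_le_trans h _; apply: le_trans (ltW n0e).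
  by rewrite ler_wiXn2l// invf_le1// ler1n.
exists l.
  apply: rhoV => /=; apply: le_lt_trans (_ : rho * 2^-1 < rho).
    by have := dl 0%N; rewrite /s big_ord0 expr1.
  by rewrite gtr_pMr// invf_lt1// ltr1n.
apply: (@closed_cvg _ _ \oo eventually_filter (fun n => ((s n).1, (s n).2))) => //.
  apply: nearW => n; have := Gs n 0 G0; rewrite scaler0 addr0.
  by case: (s n).
exact: cvg_pair.
Qed.

(** * Convex sets in finite dimension *)

Section linear_spans.
Context {R : realType} {V : lmodType R}.
Implicit Types S L : set V.

Lemma sub_linear_span S : S `<=` linear_span S.
Proof. exact: sub_smallest. Qed.

Lemma linear_span_subspace S : linear_subspace (linear_span S).
Proof.
split=> [|a x y Sx Sy] L LS; have [[L0 LD] _] := LS; first exact: L0.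
by apply: LD; [exact: Sx|exact: Sy].
Qed.

Lemma linear_span_sub S L : linear_subspace L -> S `<=` L -> linear_span S `<=` L.
Proof. by move=> lL SL; exact: smallest_sub. Qed.

Lemma linear_span_cons (s : seq V) v y : linear_span [set` v :: s] y ->
  exists (a : R) w, linear_span [set` s] w /\ y = a *: v + w.
Proof.
have [S0 SD] := linear_span_subspace [set` s].
suff : linear_span [set` v :: s] `<=`
    [set y | exists (a : R) w, linear_span [set` s] w /\ y = a *: v + w].
  by apply.
apply: linear_span_sub; first split.
- by exists 0, 0; split => //; rewrite scale0r addr0.
- move=> a _ _ [b [x [Sx ->]]] [b' [x' [Sx' ->]]].
  exists (a * b + b'), (a *: x + x'); split; first exact: SD.
  by rewrite scalerDr addrACA scalerA -scalerDl.
- move=> x /=; rewrite inE => /orP[/eqP ->|xs].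
    by exists 1, 0; split => //; rewrite scale1r addr0.
  by exists 0, x; split; [exact: sub_linear_span|rewrite scale0r add0r].
Qed.

End linear_spans.

Section finite_dimension.
Context {R : realType} {E : tvsType R}.

(** Coordinates on a finite-dimensional subspace extend to continuous functionals
    on the whole space. A new generator [v] is replaced by its part [v'] that the
    earlier vectors do not account for; if [v'] is nonzero, a functional with value
    1 at [v'], corrected to vanish on the earlier span, gives its coordinate. *)
Lemma dual_coordinates (s : seq E) : hausdorff_space E ->
  exists l : seq (E * dual E), (forall p, p \in l -> linear_span [set` s] p.1) /\
    forall y, linear_span [set` s] y -> y = \sum_(p <- l) p.2 y *: p.1.
Proof.
move=> hE; elim: s => [|v s [l [ls lE]]].
  exists [::]; split => // y; rewrite big_nil; move: y.
  suff : linear_span [set` [::]] `<=` [set 0 : E] by apply.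
  apply: linear_span_sub => //; split => //= a x y -> ->.
  by rewrite scaler0 addr0.
have sub : linear_span [set` s] `<=` linear_span [set` v :: s].
  apply: linear_span_sub; first exact: linear_span_subspace.
  by move=> x xs; apply: sub_linear_span; rewrite /= inE [x \in s]xs orbT.
have [S0 SD] := linear_span_subspace [set` v :: s].
pose T y : E := \sum_(p <- l) p.2 y *: p.1.
have Tlin a x y : T (a *: x + y) = a *: T x + T y.
  rewrite /T scaler_sumr -big_split/=; apply: eq_bigr => p _.
  by rewrite linearP scalerDl -scalerA.
pose v' := v - T v.
have [v'0|v'0] := eqVneq v' 0.
  exists l; split=> [p /ls/sub//|y /linear_span_cons[a [w [sw ->]]]].
  rewrite -/(T _) Tlin [T w]/T -lE//; congr (_ *: _ + _).
  by apply/eqP; rewrite -subr_eq0; exact/eqP.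
have [f fv'] := dual_separates hE v'0.
pose f' : dual E := f - \sum_(p <- l) f p.1 *: p.2.
have f'E y : f' y = f (y - T y).
  rewrite -[LHS]/(f y + (- \sum_(p <- l) f p.1 *: p.2 : dual E) y) linearB.
  congr (_ + _); rewrite -[LHS]/(- ((\sum_(p <- l) f p.1 *: p.2 : dual E) y)).
  congr (- _); rewrite linear_sum.
  rewrite (@big_morph _ _ (fun g : dual E => g y : R) 0 +%R)//.
  by apply: eq_bigr => p _; rewrite linearZ; exact: mulrC.
exists ((v', f') :: l); split.
  move=> p; rewrite inE => /orP[/eqP ->/=|/ls/sub//].
  rewrite /v' addrC -scaleN1r; apply: (SD).
    rewrite /T big_seq; elim/big_rec: _ => [//|q x /ls/sub sq sx].
    exact: SD.
  by apply: sub_linear_span; rewrite /= inE eqxx.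
move=> y /linear_span_cons[a [w [sw ->]]].
rewrite big_cons -[RHS]/(f' (a *: v + w) *: v' + T (a *: v + w)).
have Tw : T w = w by rewrite [T w]/T -lE.
rewrite f'E Tlin Tw opprD addrACA subrr addr0 -scalerBr -/v' linearZ/= fv'.
by rewrite [_ *: 1]mulr1 /v' scalerBr addrA subrK.
Qed.

(** In coordinates, [B] contains a segment around 0 on each axis. The coordinates of
    points near 0 are small, and a sum of two terms is a midpoint of their doubles,
    so [B] contains those points by induction on the number of axes. *)
Theorem finite_dimensional_convex_nbhs (L B : set E) : hausdorff_space E ->
  finite_dimensional L -> convex B ->
  (forall y, L y -> exists2 t : R, 0 < t & B (t *: y)) ->
  \forall y \near 0, L y -> B y.
Proof.
move=> hE [s ->] cB absB; have [L0 LD] := linear_span_subspace [set` s].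
have B0 : B 0 by have [t _] := absB _ L0; rewrite scaler0.
have [l [ls lE]] := dual_coordinates s hE.
suff : \forall y \near 0, B (\sum_(p <- l) p.2 y *: p.1).
  by apply: filterS => y + /lE yE; rewrite -yE.
elim: l ls {lE} => [_|[v f] l IH ls]; first by apply: nearW => y; rewrite big_nil.
have Lv : linear_span [set` s] v by have := ls (v, f); apply; rewrite inE eqxx.
have small t (tau : R) x : B (t *: x) -> 0 <= tau <= t -> B (tau *: x).
  move=> Bt /andP[tau0]; rewrite le_eqVlt => /orP[/eqP -> //|taut].
  have t0 : 0 < t by apply: le_lt_trans taut.
  have := cB (tau / t) _ _ _ Bt B0.
  rewrite scaler0 addr0 scalerA divfK ?gt_eqF//; apply.
  by rewrite divr_ge0 ?(ltW t0)//= ler_pdivrMr// mul1r ltW.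
have [t t0 Bt] := absB _ Lv.
have [|t' t'0 Bt'] := absB (- v).
  by rewrite -[- v]addr0 -scaleN1r; exact: LD.
have fm : nbhs (0 : E) [set y | `|f y| < Num.min t t'].
  have m0 : 0 < Num.min t t' by rewrite lt_min t0.
  have := @clin_continuous _ _ _ f 0; rewrite /continuous_at linear0.
  move=> /cvgrPdist_lt/(_ _ m0).
  by apply: filterS => y /=; rewrite sub0r normrN.
have {}IH : \forall y \near 0, B (\sum_(p <- l) p.2 y *: p.1).
  by apply: IH => p pl; apply: ls; rewrite inE pl orbT.
apply: (filterS _ (nbhs0_affine 2 0 (filterI fm IH))) => y /=; rewrite subr0 => -[f2y Bl]; rewrite big_cons/=.
have Bv : B (f (2 *: y) *: v).
  move: f2y; rewrite lt_min => /andP[/ltW ft /ltW ft'].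
  have [f0|f0] := leP 0 (f (2 *: y)).
    by apply: small Bt _; rewrite f0 (le_trans _ ft)// ler_norm.
  rewrite -[X in X *: _]opprK scaleNr -scalerN; apply: small Bt' _.
  by rewrite oppr_ge0 (ltW f0) (le_trans _ ft')// -normrN ler_norm.
have := cB 2^-1 _ _ _ Bv Bl.
have -> : 1 - 2^-1 = 2^-1 :> R by lra.
rewrite invr_ge0 ler0n invf_le1// ler1n => /(_ isT).
have f2 (g : dual E) z : g (2 *: z) = 2 * g z := linearZZ g 2 z.
rewrite f2 !scalerA mulKf ?pnatr_eq0// scaler_sumr.
congr (B (_ + _)); apply: eq_bigr => p _.
by rewrite f2 scalerA mulKf// pnatr_eq0.
Qed.

End finite_dimension.

(** * Weak-star compactness *)

Lemma ultra_fmap (S T : Type) (f : S -> T) (F : set_system S) :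
  UltraFilter F -> UltraFilter (f @ F).
Proof.
move=> FU; split; first exact: fmap_proper_filter.
move=> G GF FG; apply/seteqP; split => A; last exact: FG.
move=> GA; have [//|FnA] := in_ultra_setVsetC (f @^-1` A) FU.
have : G (~` A `&` A) by apply: filterI => //; exact: FG.
by rewrite setICl => /filter_ex[].
Qed.

Section weak_star_topology.
Context {R : realType} {E : tvsType R}.

Lemma weak_star_cvg (F : set_system (weak_star E)) (f : weak_star E) :
  Filter F -> (forall x, (g : dual E) x @[g --> F] --> ((f : dual E) x : R^o)) ->
  F --> f.
Proof.
move=> FF Ff W [_ [[B Bop <-] Bf BW]]; rewrite nbhs_filterE.
apply: filterS BW _.
pose inj (g : dual E) : {ptws E -> R^o} := g.
have : inj g @[g --> F] --> inj f.
  by apply/pointwise_cvgP => x; exact: Ff.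
by apply; apply: open_nbhs_nbhs.
Qed.

Lemma weak_star_eval_continuous x :
  continuous (fun f : weak_star E => (f : dual E) x : R^o).
Proof.
pose inj (g : dual E) : {ptws E -> R^o} := g.
move=> f; apply: (@continuous_comp (weak_star E) {ptws E -> R^o} R^o inj
  (fun g => g x)); first exact: initial_continuous.
exact: proj_continuous.
Qed.

(** Along an ultrafilter the values at each point stay in a segment, hence converge.
    The limit functional is linear, and it inherits the bound on [U], which makes it
    continuous. *)
Theorem banach_alaoglu (U : set E) (K : R) : nbhs 0 U ->
  compact ([set f : dual E | forall u, U u -> `|f u| <= K] : set (weak_star E)).
Proof.
move=> U0; rewrite compact_ultra => F FU FK.
have lim_ex x : exists a : R^o, (f : dual E) x @[f --> F] --> a.
  have [d d0 dU] := nbhs0_absorbing x U0.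
  have cpt := @segment_compact R (- (K / d)) (K / d).
  rewrite compact_ultra in cpt.
  have Ux := ultra_fmap (fun f : weak_star E => (f : dual E) x : R) FU.
  have Fx : F [set f : dual E | `[- (K / d), K / d]%classic (f x)].
    apply: filterS FK => f fK; rewrite /= in_itv/= -ler_norml.
    rewrite ler_pdivlMr// mulrC -[X in X * _](gtr0_norm d0) -normrM.
    rewrite -[X in `|X|]/(d *: f x) -linearZ; apply: fK.
    by apply: dU; rewrite gtr0_norm.
  have [a [_ ?]] := cpt _ Ux Fx.
  by exists a.
have [phi phiP] := choice lim_ex.
have lphi : linear (phi : E -> R^o).
  move=> a x y; have PF : ProperFilter F := @ultra_proper _ _ FU.
  have FF : Filter F := @filter_filter _ _ PF.
  have h : (f : dual E) (a *: x + y) @[f --> F] --> a *: phi x + phi y.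
    under eq_fun do rewrite linearP.
    have hx := @cvgZl_tmp R R^o _ F FF a _ _ (phiP x).
    exact: (@cvgD R R^o _ F FF _ _ _ _ hx (phiP y)).
  exact: (cvg_unique _ (phiP _) h).
have phiK u : U u -> `|phi u| <= K.
  move=> Uu; have PF : ProperFilter F := @ultra_proper _ _ FU.
  have FF : Filter F := @filter_filter _ _ PF.
  apply: (closed_cvg (fun r : R => r <= K) (@closed_le R K) _ _
    (@cvg_norm R R^o _ F FF _ _ (phiP u))).
  by apply: filterS FK => f; exact.
have cphi : continuous phi.
  apply: (@linear_bounded_nbhs_continuous _ _ phi U K lphi U0) => u /phiK.
  exact/le_trans/ler_norm.
have pphi : (phi : E -> R^o) \in @clin_pred R E R^o by rewrite inE.
exists (Clin pphi); split => //; exact: weak_star_cvg.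
Qed.

End weak_star_topology.

(** * The value function and its cone *)

(** An affine set through the origin is a linear subspace: x + y is twice the
    midpoint of x and y. *)
Lemma affine_hull_span {R : realType} {V : lmodType R} (S : set V) : S 0 ->
  affine_hull S = linear_span S.
Proof.
move=> S0; apply/seteqP; split.
  apply: smallest_sub; last exact: sub_linear_span.
  have [L0 LD] := linear_span_subspace S => a x y Lx Ly.
  by apply: (LD) => //; rewrite -[_ *: y]addr0; exact: LD.
have hull_affine : affine_set (affine_hull S).
  move=> a x y Sx Sy M MS; have [aM _] := MS.
  by apply: aM; [exact: Sx|exact: Sy].
have H0 : affine_hull S 0 by exact: sub_gen_smallest S0.
have HZ (a : R) x : affine_hull S x -> affine_hull S (a *: x).
  by move=> Hx; have := hull_affine a _ _ H0 Hx; rewrite scaler0 add0r.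
apply: linear_span_sub; last exact: sub_smallest.
split=> // a x y /(HZ a) Hx Hy.
have -> : a *: x + y = 2 *: ((1 - 2^-1) *: (a *: x) + 2^-1 *: y).
  have -> : 1 - 2^-1 = 2^-1 :> R by lra.
  by rewrite -scalerDr scalerA mulfV ?pnatr_eq0// scale1r.
by apply: HZ; exact: hull_affine.
Qed.

Lemma icr_sub {R : realType} {V : lmodType R} (S : set V) : S 0 -> icr S `<=` S.
Proof.
move=> S0 x /(_ 0 (sub_gen_smallest S0))[d d0 /(_ 0)].
by rewrite normr0 subr0 scale1r scale0r addr0; apply; exact: ltW.
Qed.

Lemma icr_absorbing {R : realType} {V : lmodType R} (S : set V) x y : S 0 ->
  icr S x -> linear_span S y -> exists2 t : R, 0 < t & S (x + t *: y).
Proof.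
move=> S0 icrx Sy; have [_ LD] := linear_span_subspace S.
have Sx : linear_span S x := sub_linear_span (icr_sub S0 icrx).
have := icrx (x + y); rewrite affine_hull_span//.
case=> [|d d0 /(_ d)]; first by rewrite -[x]scale1r; exact: LD.
rewrite gtr0_norm// lexx scalerDr addrA -scalerDl subrK scale1r => /(_ isT).
by exists d.
Qed.

Section conic_duality.
Context {R : realType} {X Y : tvsType R}.
Context (A : clin X Y) (P : set X) (Q : set Y) (c : dual X).
Context (cP : convex_cone P) (cQ : convex_cone Q).
Local Notation C := (range_cone A P Q).
Local Notation Y0 := (linear_span C).
Local Notation h := (value_function A P Q c).

(** Between the strict epigraph and the epigraph of the value function; unlike
    these, it does not mention an infimum and is visibly a cone. *)
Definition epi : set (Y * R^o)%type :=
  [set z | exists2 x, P x & Q (A x - z.1) /\ c x <= z.2].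

Let P0 := convex_cone0 cP.
Let Q0 := convex_cone0 cQ.

Lemma epi_cone : convex_cone epi.
Proof.
have [_ PD PZ] := cP; have [_ QD QZ] := cQ; split.
- by exists (0, 0), 0 => //=; rewrite !linear0 addr0.
- move=> [y r] [y' r'] [x Px [Qx cx]] [x' Px' [Qx' cx']].
  exists (x + x'); first exact: PD.
  rewrite !linearD/= addrACA; split; [exact: QD|exact: lerD].
- move=> t [y r] t0 [x Px [Qx cx]]; exists (t *: x); first exact: PZ.
  rewrite !linearZ/= -scalerDr; split; [exact: QZ|exact: ler_wpM2l].
Qed.

Lemma epi_up y r s : r <= s -> epi (y, r) -> epi (y, s).
Proof. by move=> rs [x Px [Qx /= cx]]; exists x => //; split => //=; lra. Qed.

Lemma epi_convex y r y' r' (t : R) : 0 <= t <= 1 -> epi (y, r) -> epi (y', r') ->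
  epi (t *: y + (1 - t) *: y', t * r + (1 - t) * r').
Proof.
move=> /andP[t0 t1] yr yr'; have [_ SD SZ] := epi_cone.
apply: (SD (t *: (y, r)) ((1 - t) *: (y', r'))); apply: SZ => //.
by rewrite subr_ge0.
Qed.

Lemma value_le y r : epi (y, r) -> (h y <= r%:E)%E.
Proof.
move=> [x Px [Qx cx]]; apply: le_trans (_ : (c x : R)%:E <= _)%E.
  by apply: ereal_inf_lbound; exists x.
by rewrite lee_fin.
Qed.

Lemma value_lt_epi y r : (h y < r%:E)%E -> epi (y, r).
Proof.
by move=> /ereal_inf_lt[_ [x [Px Qx] <-]]; rewrite lte_fin => /ltW ?; exists x.
Qed.

Lemma value_ge y v : (forall r, epi (y, r) -> v <= r) -> (v%:E <= h y)%E.
Proof.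
move=> vr; apply: le_ereal_inf_tmp => _ [x [Px Qx] <-]; rewrite lee_fin.
by apply: vr; exists x.
Qed.

Lemma epi_range y r : epi (y, r) -> C y.
Proof. by move=> [x Px [Qx _]]; exists x => //; exists (A x - y) => //; rewrite subKr. Qed.

Lemma range_epi y : C y -> exists r, epi (y, r).
Proof. by move=> [x Px [q Qq <-]]; exists (c x), x => //; rewrite /= subKr. Qed.

Lemma range0 : C 0.
Proof. by exists 0 => //; exists 0 => //; rewrite linear0 subr0. Qed.

Let spanD := (linear_span_subspace C).2.

Let spanB y z : Y0 y -> Y0 z -> Y0 (y - z).
Proof. by move=> Yy Yz; rewrite addrC -scaleN1r; exact: spanD. Qed.

Lemma dual_feasibleP (f : dual Y) :
  dual_feasible A P Q c f <-> forall y r, epi (y, r) -> f y <= r.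
Proof.
split=> [[fQ [g gP fE]] y r [x Px [Qx /= cx]]|fepi].
  have gx := gP _ Px; have fx := fQ _ Qx; rewrite linearB/= in fx.
  have : (- g : dual X) x = (adjoint A f - c : dual X) x by rewrite fE.
  rewrite -[LHS]/(- g x) -[RHS]/(f (A x) - c x); lra.
split=> [q Qq|].
  rewrite -oppr_le0 -linearN; apply: fepi; exists 0 => //=.
  by rewrite !linear0 sub0r opprK.
exists (c - adjoint A f); last by rewrite opprB.
move=> x Px; rewrite -[leRHS]/(c x - f (A x)) subr_ge0; apply: fepi.
by exists x => //=; rewrite subrr.
Qed.

Lemma feasible_le_value (f : dual Y) y : dual_feasible A P Q c f ->
  ((f y : R)%:E <= h y)%E.
Proof. by move=> /dual_feasibleP fe; apply: value_ge => r; exact: fe. Qed.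

Lemma weak_duality b : (val_dual A P Q c b <= val_primal A P Q c b)%E.
Proof. by apply: ge_ereal_sup => _ [f ff <-]; exact: feasible_le_value. Qed.

Lemma value_ninfty y : (forall r, epi (y, r)) -> h y = -oo%E.
Proof.
move=> yr; have : forall r : R, (h y <= r%:E)%E by move=> r; exact: value_le.
case: (h y) => [s /(_ (s - 1)%R)|/(_ 0%R)|//]; last by rewrite leye_eq.
by rewrite lee_fin lerDl oppr_ge0 ler10.
Qed.

(** A point of the intrinsic core lies strictly between [y0] and another point of
    the domain, over which [epi] is nonempty. *)
Lemma epi_icr_unbounded y0 y : (forall r, epi (y0, r)) -> icr C y ->
  forall r, epi (y, r).
Proof.
move=> y0r icry r; have Yy : Y0 y := sub_linear_span (icr_sub range0 icry).
have Yy0 : Y0 y0 := sub_linear_span (epi_range (y0r 0)).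
have [t t0 /range_epi[s ys]] := icr_absorbing range0 icry (spanB Yy Yy0).
have t1 : 0 < 1 + t by lra.
have t1V : 0 < (1 + t)^-1 by rewrite invr_gt0.
have /epi_convex/(_ ys (y0r ((1 + t) / t * (r - (1 + t)^-1 * s)))) :
    0 <= (1 + t)^-1 <= 1 by rewrite ltW//= invf_le1//; lra.
have -> : 1 - (1 + t)^-1 = t / (1 + t) by field; apply: lt0r_neq0.
have -> : (1 + t)^-1 * s + t / (1 + t) * ((1 + t) / t * (r - (1 + t)^-1 * s)) = r.
  by field; rewrite ?lt0r_neq0.
suff -> : (1 + t)^-1 *: (y + t *: (y - y0)) + t / (1 + t) *: y0 = y by [].
rewrite scalerBr addrA -[X in X + t *: y]scale1r -scalerDl scalerBr !scalerA.
by rewrite mulVf ?gt_eqF// scale1r [_ * t]mulrC subrK.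
Qed.

Section bounded_near.
Context (b : Y) (M : R).
Context (Yb : Y0 b) (bM : \forall y \near b, Y0 y -> epi (y, M)).

(** A neighborhood of [b] in the span on which the value is below +oo lies in
    the cone. *)
Lemma bounded_near_icr : icr C b.
Proof.
move=> x; rewrite affine_hull_span; last exact: range0.
move=> Yx; have [d d0 bd] := nbhs0_absorbing (x - b) (nbhs_translate bM).
exists d => // l /bd/= bl.
have -> : (1 - l) *: b + l *: x = b + l *: (x - b).
  by rewrite scalerBl scale1r scalerBr addrA addrAC.
by apply/epi_range/bl; rewrite addrC; apply: (spanD) => //; exact: spanB.
Qed.

(** The dual solution is a subgradient of the value function at [b]. *)
Lemma strong_duality v : (forall r, epi (b, r) -> v <= r) ->
  exists2 f : dual Y, dual_feasible A P Q c f & h b = (f b : R)%:E.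
Proof.
move=> vb; have bM' : epi (b, M) := nbhs_singleton bM Yb.
have hfin : h b \is a fin_num.
  rewrite fin_numElt (lt_le_trans _ (value_ge vb)) ?ltNyr//=.
  by rewrite (le_lt_trans (value_le bM')) ?ltry.
have epi_fine r : epi (b, r) -> fine (h b) <= r.
  by move=> /value_le; rewrite -{1}(fineK hfin) lee_fin.
have epiY y r : epi (y, r) -> Y0 y by move=> /epi_range/sub_linear_span.
have [f fe fb] := subgradient_exists epi_cone (linear_span_subspace C) epiY Yb bM
  epi_fine.
have ff : dual_feasible A P Q c f by apply/dual_feasibleP.
exists f => //; apply/le_anti/andP; split; last exact: feasible_le_value.
by rewrite -(fineK hfin) lee_fin.
Qed.

(** The subgradient [f] bounds the value from below. From above, a point y near [b]
    is a convex combination of [b] and of z = b + (y - b) / t, where the value is at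
    most [M]; the weight [t] of z is small. *)
Lemma value_continuous (f : dual Y) : dual_feasible A P Q c f ->
  h b = (f b : R)%:E -> h y @[y --> (b : subspace Y0)] --> h b.
Proof.
move=> ff hb; have bM' : epi (b, M) := nbhs_singleton bM Yb.
have close (e : R) : 0 < e -> \forall y \near b, Y0 y ->
    (((f b : R) - e)%:E <= h y)%E /\ (h y <= ((f b : R) + e)%:E)%E.
  move=> e0; have fbM : f b <= M by rewrite -lee_fin -hb; exact: value_le.
  (* Small enough for t (M - f b) <= e / 2; the summand [e] avoids a division by 0
     and gives t <= 1. *)
  pose t := e / 2 / (M - f b + e).
  have den0 : 0 < M - f b + e by lra.
  have t0 : 0 < t by rewrite !divr_gt0.
  have t1 : t <= 1 by rewrite ler_pdivrMr//; lra.
  have tM : t * (M - f b) <= e / 2.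
    have : t * (M - f b + e) = e / 2 by rewrite divfK// gt_eqF.
    have : 0 <= t * e by rewrite mulr_ge0 ?ltW.
    lra.
  have be : epi (b, f b + e / 2).
    by apply: value_lt_epi; rewrite hb lte_fin; lra.
  have fcont : \forall y \near b, `|f b - f y| < e.
    have /cvgrPdist_lt := @clin_continuous _ _ _ f b; exact.
  have zM := nbhs0_affine t^-1 b (nbhs_translate bM).
  apply: filterS2 fcont zM => y fy zM Yy; split.
    apply: le_trans (feasible_le_value y ff); rewrite lee_fin.
    by move: fy; rewrite ltr_norml; lra.
  have Yz : Y0 (b + t^-1 *: (y - b)).
    by rewrite addrC; apply: (spanD) => //; exact: spanB.
  have /epi_convex/(_ (zM Yz) be) : 0 <= t <= 1 by rewrite ltW.
  have -> : t *: (b + t^-1 *: (y - b)) + (1 - t) *: b = y.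
    rewrite scalerDr scalerA mulfV ?gt_eqF// scale1r addrAC -scalerDl.
    by rewrite [t + _]addrCA subrr addr0 scale1r addrC subrK.
  move=> /value_le/le_trans; apply; rewrite lee_fin.
  have : 0 <= t * (e / 2) by rewrite mulr_ge0 ?ltW// divr_gt0.
  by move: tM; rewrite !mulrBr !mulrBl !mulrDr !mul1r; lra.
have near_subspace (D : set Y) : (\forall y \near b, Y0 y -> D y) ->
    nbhs (b : subspace Y0) D.
  move=> bD; suff : within Y0 (nbhs b) D by rewrite nbhs_subspace_in.
  exact: bD.
have fin_near (e : R) y : ((f b - e)%:E <= h y)%E -> (h y <= (f b + e)%:E)%E ->
    h y \is a fin_num.
  by move=> lo hi; rewrite fin_numElt (lt_le_trans _ lo) ?ltNyr// (le_lt_trans hi) ?ltry.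
have FF : Filter (nbhs (b : subspace Y0)) := @nbhs_filter _ _.
rewrite hb; apply/(@fine_cvgP _ _ _ FF); split.
  apply: near_subspace; apply: filterS (close 1 ltr01) => y /[apply] -[lo hi].
  exact: fin_near lo hi.
apply/(@cvgrPdist_le _ _ _ _ FF) => e e0; apply: near_subspace.
apply: filterS (close e e0) => y /[apply] -[lo hi].
have hy := fin_near _ _ lo hi.
by move: lo hi; rewrite -(fineK hy) !lee_fin /= ler_norml; lra.
Qed.

End bounded_near.

(** Any bound above M works at the price of a shorter step: the value is convex, at
    most M at [b] and below +oo somewhere on the ray from [b] along [y]. *)
Lemma epi_absorbing b y M : icr C b -> epi (b, M) -> Y0 y ->
  exists2 t : R, 0 < t & epi (b + t *: y, M + 1).
Proof.
move=> icrb bM Yy; have [t t0 /range_epi[m ym]] := icr_absorbing range0 icrb Yy.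
pose s := (1 + `|m - M|)^-1; have den : 0 < 1 + `|m - M| by rewrite ltr_wpDr.
have s0 : 0 < s by rewrite invr_gt0.
have s01 : 0 <= s <= 1 by rewrite ltW//= invf_le1// lerDl.
exists (s * t); first exact: mulr_gt0.
have -> : b + (s * t) *: y = s *: (b + t *: y) + (1 - s) *: b.
  by rewrite scalerDr scalerA addrAC -scalerDl [s + _]addrCA subrr addr0 scale1r.
apply: epi_up (epi_convex s01 ym bM); rewrite mulrBl mul1r.
have : s * (m - M) <= 1.
  rewrite mulrC ler_pdivrMr// mul1r; have := ler_norm (m - M); lra.
lra.
Qed.

Lemma epi_translate_convex b M : convex [set y | epi (b + y, M)].
Proof.
move=> t y z t01 yM zM; have := epi_convex t01 yM zM.
have t1 : t + (1 - t) = 1 by rewrite addrC subrK.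
by rewrite -mulrDl t1 mul1r !scalerDr addrACA -scalerDl t1 scale1r.
Qed.

Lemma bounded_near_of_translate b M : Y0 b ->
  (\forall y \near 0, Y0 y -> epi (b + y, M)) ->
  \forall y \near b, Y0 y -> epi (y, M).
Proof.
move=> Yb /(nbhs0_affine 1 b); apply: filterS => y /= + Yy.
by rewrite scale1r => /(_ (spanB Yy Yb)); rewrite addrC subrK.
Qed.

End conic_duality.

(** * Qualification conditions and the set of dual solutions *)

Lemma continuous_translate {R : realType} {T : topologicalType} {E : tvsType R}
  (a : E) (f : T -> E) : continuous f -> continuous (fun z => a + f z).
Proof.
move=> cf z; apply: (@continuous_comp _ _ _ (fun z => (a, f z))
  (fun y : E * E => y.1 + y.2)); last exact: add_continuous.
by apply: cvg_pair; [exact: cvg_cst|exact: cf].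
Qed.

Section qualification.
Context {R : realType} {X Y : tvsType R}.
Context (A : clin X Y) (P : set X) (Q : set Y) (c : dual X).
Context (cP : convex_cone P) (cQ : convex_cone Q) (b : Y).
Local Notation C := (range_cone A P Q).
Local Notation Y0 := (linear_span C).
Local Notation epi := (epi A P Q c).

Let spanD := (linear_span_subspace C).2.

(** The single point [x0] stays feasible for all right-hand sides near [b]. *)
Lemma interior_bounded x0 : P x0 -> rel_interior Y0 Q (A x0 - b) ->
  Y0 b /\ \forall y \near b, Y0 y -> epi (y, c x0).
Proof.
move=> Px0 [Yx0b]; rewrite -[nbhs _]nbhs_subspace_in// => Qnear.
have Qx0b : Q (A x0 - b) := nbhs_singleton Qnear Yx0b.
have Yb : Y0 b.
  by apply: sub_linear_span; exists x0 => //; exists (A x0 - b) => //; rewrite subKr.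
split=> //; have := nbhs0_affine (-1) b (nbhs_translate Qnear).
apply: filterS => y /= Qy Yy; exists x0 => //=; split => //.
have yE : A x0 - b + -1 *: (y - b) = A x0 - y.
  by rewrite scaleN1r opprB addrA subrK.
rewrite -yE; apply: Qy; rewrite yE addrC -scaleN1r; apply: spanD => //.
apply: sub_linear_span; exists x0 => //; exists 0; first exact: convex_cone0.
by rewrite subr0.
Qed.

Lemma finite_dimensional_bounded : hausdorff_space Y -> finite_dimensional Y0 ->
  icr C b -> exists M, \forall y \near b, Y0 y -> epi (y, M).
Proof.
move=> hY finY0 icrb; have Cb : C b := icr_sub (range0 A cP cQ) icrb.
have [M bM] := range_epi c Cb; exists (M + 1).
apply: (bounded_near_of_translate (sub_linear_span Cb)).
apply: (@finite_dimensional_convex_nbhs _ _ Y0 [set y | epi (b + y, M + 1)]) => //.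
  exact: epi_translate_convex.
by move=> y; exact: epi_absorbing.
Qed.

(** The feasibility relation, translated to a feasible pair (x0, b), has a closed
    convex graph, so by [robinson_ursescu] the points near [b] are reached from
    points near [x0], where [c] is at most c x0 + 1. *)
Lemma frechet_bounded : frechet_space X -> frechet_space Y ->
  closed P -> closed Q -> closed Y0 -> icr C b ->
  exists M, \forall y \near b, Y0 y -> epi (y, M).
Proof.
move=> fX fY clP clQ clY0 icrb; have Cb : C b := icr_sub (range0 A cP cQ) icrb.
have Yb : Y0 b := sub_linear_span Cb.
have [x0 Px0 [q Qq bE]] := Cb.
pose G := [set z : (X * Y)%type | P (x0 + z.1) /\ Q (A (x0 + z.1) - (b + z.2))].
exists (c x0 + 1); apply: bounded_near_of_translate => //.
have cG : convex G.
  move=> t [x y] [x' y'] /andP[t0 t1] [Px Qx] [Px' Qx'].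
  have [_ PD PZ] := cP; have [_ QD QZ] := cQ.
  have t1' : 0 <= 1 - t by rewrite subr_ge0.
  have tE (Z : lmodType R) (u v w : Z) :
      u + (t *: v + (1 - t) *: w) = t *: (u + v) + (1 - t) *: (u + w).
    rewrite !scalerDr addrACA -scalerDl; congr (_ + _).
    by rewrite addrC subrK scale1r.
  split=> /=; rewrite !tE; first by apply: PD; exact: PZ.
  rewrite linearD !linearZ/= opprD addrACA -!scalerBr.
  by apply: QD; exact: QZ.
have clG : closed G.
  have contX : continuous (fun z : X * Y => x0 + z.1).
    by apply: continuous_translate => z; exact: cvg_fst.
  have contY : continuous (fun z : X * Y => A (x0 + z.1) - (b + z.2)).
    move=> z; apply: (@continuous_comp _ _ _
      (fun z : X * Y => (A (x0 + z.1), b + z.2)) (fun y : Y * Y => y.1 - y.2));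
      last exact: sub_continuous.
    apply: cvg_pair.
      exact: (@continuous_comp _ _ _ (fun z : X * Y => x0 + z.1) A z (contX z)
        (@clin_continuous _ _ _ A _)).
    by apply: continuous_translate => {}z; exact: cvg_snd.
  apply: closedI; first exact: (continuous_closedP _).1 contX _ clP.
  exact: (continuous_closedP _).1 contY _ clQ.
have V0 : nbhs (0 : X) [set x | `|c x| < 1].
  have := @clin_continuous _ _ _ c 0; rewrite /continuous_at linear0.
  move=> /cvgrPdist_lt/(_ _ ltr01).
  by apply: filterS => x /=; rewrite sub0r normrN.
have G0 : G 0.
  by split; rewrite /= !addr0// -bE subKr.
have GY z : G z -> Y0 z.2.
  case: z => x y [/= Px Qx]; have /sub_linear_span Yby : C (b + y).
    by exists (x0 + x) => //; exists (A (x0 + x) - (b + y)) => //; rewrite subKr.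
  have -> : y = -1 *: b + (b + y) by rewrite scaleN1r addKr.
  exact: spanD.
have absG y : Y0 y -> exists2 t : R, 0 < t & exists x, G (x, t *: y).
  move=> Yy; have [t t0 [x Px [q' Qq' byE]]] :=
    icr_absorbing (range0 A cP cQ) icrb Yy.
  have xE : x0 + (x - x0) = x by rewrite addrC subrK.
  by exists t => //; exists (x - x0); split; rewrite /= xE// -byE subKr.
have := robinson_ursescu fX fY (linear_span_subspace C) clY0 clG cG G0 GY absG V0.
apply: filterS => y + Yy => /(_ Yy)[x /= cx [Px Qx]]; exists (x0 + x) => //.
split => //=; rewrite linearD/=.
by have := ler_norm (c x); lra.
Qed.

(** The bound [M] on the value near [b] and the common value of the solutions at [b]
    bound all solutions on one neighborhood of 0. *)
Lemma sol_dual_compact M : (\forall y \near b, epi (y, M)) ->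
  forall f0, sol_dual A P Q c b f0 ->
  compact (sol_dual A P Q c b : set (weak_star Y)).
Proof.
move=> bM f0 [_ f0b].
pose ev y (f : weak_star Y) : R^o := (f : dual Y) y.
pose D : set (weak_star Y) :=
  (\bigcap_(z in epi) (ev z.1 @^-1` [set s | s <= z.2])) `&`
  (ev b @^-1` [set s | s = f0 b]).
have solD : sol_dual A P Q c b = D.
  apply/seteqP; split=> f [fe fb]; have fP := dual_feasibleP A c cP cQ f.
    split; first by move=> [y r]; exact: (fP.1 fe).
    have : (f b : R)%:E = (f0 b : R)%:E by rewrite fb f0b.
    by case.
  split; first by apply/fP => y r yr; exact: (fe (y, r)).
  by rewrite -f0b; congr EFin; exact: fb.
have [U [U0 UM cU UN]] := convex_nbhs0 (nbhs_translate bM).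
have BA := @banach_alaoglu R Y U (M - f0 b) U0.
rewrite solD; apply: (@subclosed_compact (weak_star Y) _ _ _ BA).
  have evC y := (continuous_closedP (ev y)).1 (@weak_star_eval_continuous _ _ y).
  apply: closedI; last exact: (evC b _ (@closed_eq R (f0 b))).
  by apply: closed_bigI => z _; exact: (evC z.1 _ (@closed_le R z.2)).
move=> f [fe fb] u Uu.
have fu w : U w -> f w <= M - f0 b.
  move=> /UM/(fe (_, _)); rewrite /ev/= linearD/=.
  by move: fb; rewrite /ev/= => ->; lra.
by rewrite ler_norml lerNl -linearN !fu//; exact: UN.
Qed.

End qualification.

(** * Strong duality *)

Theorem proposition2 (R : realType) (X Y : tvsType R)
  (hX : hausdorff_space X) (hY : hausdorff_space Y)
  (A : clin X Y) (P : set X) (Q : set Y)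
  (cP : convex_cone P) (cQ : convex_cone Q) (c : dual X) (b : Y) :
  let Y0 : set Y := linear_span (range_cone A P Q) in
  let h : Y -> \bar R := value_function A P Q c in
  let N0 (l0 : R) : set Y :=
    [set y | exists2 x, P x & Q (A x - y) /\ c x <= l0] in
  let case_a :=
    [/\ forall y, icr (range_cone A P Q) y -> h y = -oo%E,
        val_primal A P Q c b = -oo%E & val_dual A P Q c b = -oo%E] in
  let case_b :=
    [set p + adjoint A q | p in pos_dual P & q in pos_dual Q] c /\
    (h y @[y --> (b : subspace Y0)] --> h b) in
  [\/ exists l0 : R, rel_nbhs Y0 b (N0 l0),
      exists2 x0, P x0 & rel_interior Y0 Q (A x0 - b),
      [/\ frechet_space X /\ frechet_space Y,
          [/\ closed P, closed Q & closed Y0] &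
          icr (range_cone A P Q) b] |
      finite_dimensional Y0 /\ icr (range_cone A P Q) b] ->
  (case_a \/ case_b) /\
  (case_b ->
   [/\ subdifferential h b !=set0,
       val_primal A P Q c b = val_dual A P Q c b,
       val_primal A P Q c b \is a fin_num,
       sol_dual A P Q c b !=set0 &
       Y0 = setT -> compact (sol_dual A P Q c b : set (weak_star Y))]).
Proof.
move=> Y0 h N0 case_a case_b cond.
have [Yb [M bM]] : Y0 b /\ exists M, \forall y \near b, Y0 y ->
    epi A P Q c (y, M).
  have icrY0 : icr (range_cone A P Q) b -> Y0 b.
    by move=> /(icr_sub (range0 A cP cQ))/sub_linear_span.
  case: cond => [[l0 [Yb]]|[x0 Px0]|[[fX fY] [clP clQ clY] icrb]|[finY icrb]].
  - by rewrite -[nbhs _]nbhs_subspace_in// => bM; split => //; exists l0; exact: bM.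
  - move=> /(interior_bounded c cQ Px0)[Yb bM]; split => //.
    by exists (c x0); exact: bM.
  - by split; [exact: icrY0|exact: frechet_bounded].
  - by split; [exact: icrY0|exact: finite_dimensional_bounded].
split.
  have [[y0 y0r]|ninf] := pselect (exists y0, forall r, epi A P Q c (y0, r)).
    left; have hicr y : icr (range_cone A P Q) y -> h y = -oo%E.
      move=> icry; apply: value_ninfty => r.
      exact: (epi_icr_unbounded cP cQ y0r icry).
    have hb : h b = -oo%E by apply: hicr; exact: bounded_near_icr bM.
    split => //; apply/eqP; rewrite -leeNy_eq -hb; exact: weak_duality.
  right.
  have [v vb] : exists v, forall r, epi A P Q c (b, r) -> v <= r.
    have [v nv] : exists v, ~ epi A P Q c (b, v).
      by apply/existsNP => bv; apply: ninf; exists b.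
    exists v => r br; rewrite leNgt; apply/negP => rv; apply: nv.
    by apply: epi_up br; exact: ltW.
  have [f ff hb] := strong_duality cP cQ Yb bM vb.
  split; last exact: (value_continuous cP cQ Yb bM ff hb).
  have [fQ [p pP fE]] := ff.
  exists p => //; exists f => //.
  by rewrite -[p]opprK fE opprB subrK.
move=> [[p pP [q qQ pqc]] _].
have fq : dual_feasible A P Q c q.
  split=> //; exists p => //.
  by rewrite -pqc opprD addrCA subrr addr0.
have qb r : epi A P Q c (b, r) -> q b <= r by exact: (dual_feasibleP A c cP cQ q).1 fq b r.
have [f ff hb] := strong_duality cP cQ Yb bM qb.
have valE : val_dual A P Q c b = (f b : R)%:E.
  apply/le_anti/andP; split; first by rewrite -hb; exact: weak_duality.
  by apply: ereal_sup_ubound; exists f.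
have sf : sol_dual A P Q c b f by split.
split.
- exists f; split; first by rewrite [h b]hb.
  move=> y; rewrite [h b]hb linearB/= EFinB.
  exact: (leeD2r _ (feasible_le_value cP cQ y ff)).
- by rewrite valE -hb.
- by rewrite -[val_primal _ _ _ _ _]/(value_function A P Q c b) hb.
- by exists f.
- move=> YT; apply: sol_dual_compact sf => //.
  by apply: filterS bM => y; apply; rewrite YT.
Qed.
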